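(* Let $(G,+)$ be an abelian group and let $[\cdot,\cdot]:G^{\times 2}\to G$ be a group homomorphism in both arguments, i.e. $[a+b,c]=[a,c]+[b,c]$ and $[a,b+c]=[a,b]+[a,c]$ for all $a,b,c\in G$. Let $n\geq 2$ and let $f:G^{\times n}\to G^{\times n}$ be defined by $$f(x_1,\dots,x_n)=\Bigl(-\sum_{l=1}^{n}x_l,\,x_3,x_4,\dots,x_n,x_1\Bigr).$$ For maps $\psi:G^{\times n}\to G$ define $\partial_{[\cdot,\cdot]}\psi:G^{\times n}\to G$ by $$(\partial_{[\cdot,\cdot]}\psi)(x_1,\dots,x_n)=\Bigl[\sum_{i=1}^{n}x_i,\ \psi(x_1,\dots,x_n)+\sum_{i=1}^{n}(\psi\circ f^i)(x_1,\dots,x_n)\Bigr].$$ Then: (1) $\partial_{[\cdot,\cdot]}$ is a linear (additive) map from the group of all maps $G^{\times n}\to G$ to itself with $\partial_{[\cdot,\cdot]}\circ\partial_{[\cdot,\cdot]}=0$. (2) $\partial_{[\cdot,\cdot]}$ restricts to symmetric maps: if $\psi$ is symmetric then so is $\partial_{[\cdot,\cdot]}\psi$, and for symmetric $\psi$ one has $$(\partial_{[\cdot,\cdot]}\psi)(x_1,\dots,x_n)=\Bigl[\sum_{i=1}^{n}x_i,\ \psi(x_1,\dots,x_n)+\sum_{i=1}^{n}\psi\Bigl(x_1,\dots,x_{i-1},-\sum_{l=1}^{n}x_l,x_{i+1},\dots,x_n\Bigr)\Bigr].$$ (3) For $n=2$, where $f(x,y)=(-x-y,x)$ and $f^2(x,y)=\tilde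 f(x,y)=(y,-x-y)$, parity is conserved: if $\psi(x,y)=\pm\psi(y,x)$ for all $x,y\in G$, then $(\partial_{[\cdot,\cdot]}\psi)(x,y)=\pm(\partial_{[\cdot,\cdot]}\psi)(y,x)$ for all $x,y\in G$ (with the same sign).
   Context: Maps $G^{\times n}\to G$ are arbitrary set maps and form an abelian group under pointwise addition. A map $\psi:G^{\times n}\to G$ is symmetric if it is invariant under all permutations of its arguments. $f^i$ denotes the $i$-fold composition of $f$ with itself. For $n=2$ the formula for $f$ reads $f(x_1,x_2)=(-x_1-x_2,x_1)$. *)

(* Defs.v *)
From HB Require Import structures.
From mathcomp Require Import all_boot all_order all_fingroup all_algebra.
(* for the group structure on [T -> G]: pointwise addition *)
From mathcomp Require Import functions.

Set Implicit Arguments.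
Unset Strict Implicit.
Unset Printing Implicit Defensive.

Import GRing.Theory.
Local Open Scope ring_scope.

Definition tsum (G : zmodType) (n : nat) (x : n.-tuple G) : G :=
  \sum_(l < n) tnth x l.

(* f (x_1, ..., x_n) = (- \sum_l x_l, x_3, ..., x_n, x_1).
   Indices here start at 0: entry 0 is the negated sum, and entry i > 0 is the
   entry of x at the cyclic successor [ordS i] of i.  So entry 1 is x_3 (or x_1
   when n = 2), the last entry is x_1, and x_2 is dropped. *)
Definition fmap (G : zmodType) (n : nat) (x : n.-tuple G) : n.-tuple G :=
  [tuple if i == 0%N :> nat then - tsum x else tnth x (ordS i) | i < n].

Definition bdiff (G : zmodType) (br : G -> G -> G) (n : nat)
    (psi : n.-tuple G -> G) : n.-tuple G -> G :=
  fun x => br (tsum x)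
              (psi x + \sum_(1 <= i < n.+1) psi (iter i (@fmap G n) x)).

Definition symmetric_map (G : zmodType) (n : nat) (psi : n.-tuple G -> G) :
    Prop :=
  forall (s : 'S_n) (x : n.-tuple G), psi [tuple tnth x (s i) | i < n] = psi x.

Definition subst_negsum (G : zmodType) (n : nat) (i : 'I_n) (x : n.-tuple G) :
    n.-tuple G :=
  [tuple if j == i then - tsum x else tnth x j | j < n].

(* Main.v *)
(* Put [x_0 = - (x_1 + ... + x_n)].  The list [x_0, x_2, x_3, ..., x_n, x_1] has
   sum zero, and [f] rotates it by one step.  Hence [f] has order dividing
   [n + 1], the sum of [psi] over the orbit of [x] is [f]-invariant, and the
   sums of the entries of [x, f x, ..., f^n x] are the [- x_i], which add up to zero.
   So the inner bracket in the square of the differential can be pulled out of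
   the orbit sum and becomes [[0, _]].  The entries of [f^i x] are all the
   [x_j] but one, which gives the formula for symmetric maps. *)
Require Import Defs.
From HB Require Import structures.
From mathcomp Require Import all_boot all_order all_fingroup all_algebra.
From mathcomp Require Import boolp functions.

Set Implicit Arguments.
Unset Strict Implicit.
Unset Printing Implicit Defensive.

Import GRing.Theory.
Local Open Scope ring_scope.

(** * The zero-sum list [cyc x], which [fmap] rotates *)

Definition cyc (G : zmodType) (n : nat) (x : n.-tuple G) : seq G :=
  - tsum x :: rot 1 x.

Lemma tsumE (G : zmodType) (n : nat) (x : n.-tuple G) :
  tsum x = \sum_(a <- x) a.
Proof. by rewrite /tsum [RHS]big_tuple. Qed.

Lemma size_cyc (G : zmodType) (n : nat) (x : n.-tuple G) :
  size (cyc x) = n.+1.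
Proof. by rewrite /= size_rot size_tuple. Qed.

Lemma perm_cyc (G : zmodType) (n : nat) (x : n.-tuple G) :
  perm_eq (cyc x) (- tsum x :: x).
Proof. by rewrite perm_cons perm_rot. Qed.

Lemma sum_cyc (G : zmodType) (n : nat) (x : n.-tuple G) :
  \sum_(a <- cyc x) a = 0.
Proof.
by rewrite (perm_big _ (perm_cyc x)) big_cons /= -tsumE addNr.
Qed.

Lemma cyc_inj (G : zmodType) (n : nat) : injective (@cyc G n).
Proof. by move=> x y [_ /rot_inj /val_inj]. Qed.

Lemma nth_rot1 (T : Type) (d : T) (n : nat) (x : n.-tuple T) (i : 'I_n) :
  nth d (rot 1 x) i = tnth x (ordS i).
Proof.
case: n x i => [|n] x i; first by case: i.
rewrite (tnth_nth d) /=; case/tupleP: x => a l /=.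
rewrite rot1_cons nth_rcons size_tuple.
have := ltn_ord i; rewrite ltnS leq_eqVlt => /predU1P[-> | lt_in].
  by rewrite ltnn eqxx modnn.
by rewrite lt_in modn_small.
Qed.

Lemma val_fmap (G : zmodType) (n : nat) (x : n.+1.-tuple G) :
  fmap x = - tsum x :: behead (rot 1 x) :> seq G.
Proof.
apply: (@eq_from_nth _ 0) => [|i].
  by rewrite size_tuple /= size_behead size_rot size_tuple.
rewrite size_tuple => lt_in; rewrite -(tnth_nth 0 (fmap x) (Ordinal lt_in)).
rewrite tnth_mktuple /=; case: i lt_in => [|i] lt_in //=.
by rewrite nth_behead -(nth_rot1 0 x (Ordinal lt_in)).
Qed.

(** The entries of [fmap x] are those of [cyc x] except the head of [rot 1 x]. Since [cyc x] sums to
    zero, that omitted entry is the negated sum of [fmap x], hence the new head. *)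
Lemma cyc_fmap (G : zmodType) (n : nat) (x : n.+1.-tuple G) :
  cyc (fmap x) = rot 1 (cyc x).
Proof.
have E : tsum x = \sum_(a <- rot 1 x) a.
  by rewrite tsumE; apply/perm_big; rewrite perm_sym perm_rot.
rewrite /cyc rot1_cons tsumE val_fmap rot1_cons.
case: (rot 1 x) (size_rot 1 x) E => [|b l]; first by rewrite size_tuple.
by move=> _ ->; rewrite !big_cons /= opprD opprK addrK.
Qed.

Lemma cyc_iter_fmap (G : zmodType) (n i : nat) (x : n.+1.-tuple G) :
  (* The bound matters because [rot i] is the identity once [i] exceeds the length; the endpoint
     [n.+2], a full turn, yields periodicity. *)
  (i <= n.+2)%N -> cyc (iter i (@fmap G n.+1) x) = rot i (cyc x).
Proof.
elim: i => [|i IHi] le_in; first by rewrite rot0.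
by rewrite iterS cyc_fmap IHi 1?ltnW // -rotS // size_cyc.
Qed.

Lemma iter_fmap_id (G : zmodType) (n : nat) (x : n.+1.-tuple G) :
  iter n.+2 (@fmap G n.+1) x = x.
Proof.
by apply: cyc_inj; rewrite cyc_iter_fmap // -(size_cyc x) rot_size.
Qed.

Lemma nth0_rot (T : Type) (d : T) (s : seq T) (i : nat) :
  (i < size s)%N -> nth d (rot i s) 0 = nth d s i.
Proof.
by move=> lt_is; rewrite nth_cat size_drop subn_gt0 lt_is nth_drop addn0.
Qed.

Lemma tsum_iter_fmap (G : zmodType) (n i : nat) (x : n.+1.-tuple G) :
  (i < n.+2)%N -> tsum (iter i (@fmap G n.+1) x) = - (cyc x)`_i.
Proof.
(* The head of [cyc y] is [- tsum y] by definition, so the sum is read off the head of the rotated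
   list. *)
move=> lt_in; rewrite -[LHS]opprK -[- tsum _]/((cyc _)`_0).
by rewrite cyc_iter_fmap ?(ltnW lt_in) // nth0_rot // size_cyc.
Qed.

Lemma sum_tsum_iter_fmap (G : zmodType) (n : nat) (x : n.+1.-tuple G) :
  \sum_(0 <= i < n.+2) tsum (iter i (@fmap G n.+1) x) = 0.
Proof.
apply/oppr_inj; rewrite oppr0 -[RHS](sum_cyc x) [RHS](big_nth 0) size_cyc.
rewrite -sumrN.
by apply: eq_big_nat => i /andP[_ lt_in]; rewrite tsum_iter_fmap // opprK.
Qed.

(** * Orbit sums, additivity and the square of the differential *)

Definition orbit_sum (G : zmodType) (n : nat) (psi : n.-tuple G -> G)
    (x : n.-tuple G) : G :=
  \sum_(0 <= i < n.+1) psi (iter i (@fmap G n) x).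

Lemma bdiffE (G : zmodType) (br : G -> G -> G) (n : nat)
    (psi : n.-tuple G -> G) (x : n.-tuple G) :
  bdiff br psi x = br (tsum x) (orbit_sum psi x).
Proof. by rewrite /bdiff /orbit_sum [in RHS]big_ltn. Qed.

Lemma orbit_sum_fmap (G : zmodType) (n : nat) (psi : n.+1.-tuple G -> G)
    (x : n.+1.-tuple G) :
  orbit_sum psi (fmap x) = orbit_sum psi x.
Proof.
rewrite /orbit_sum [RHS]big_nat_recl // big_nat_recr // addrC -iterSr.
rewrite iter_fmap_id; congr (_ + _).
by apply: eq_bigr => i _; rewrite -iterSr.
Qed.

Lemma orbit_sum_iter_fmap (G : zmodType) (n i : nat)
    (psi : n.+1.-tuple G -> G) (x : n.+1.-tuple G) :
  orbit_sum psi (iter i (@fmap G n.+1) x) = orbit_sum psi x.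
Proof. by elim: i => //= i IHi; rewrite orbit_sum_fmap. Qed.

Lemma bdiffD (G : zmodType) (br : G -> G -> G)
    (brDr : forall a b c : G, br a (b + c) = br a b + br a c) (n : nat)
    (psi phi : n.-tuple G -> G) :
  bdiff br (psi + phi) = bdiff br psi + bdiff br phi.
Proof.
apply/funext => x; rewrite /= bdiffE.
rewrite [RHS](_ : _ = bdiff br psi x + bdiff br phi x) // !bdiffE -brDr.
by rewrite /orbit_sum -big_split.
Qed.

Lemma bdiff_bdiff (G : zmodType) (br : G -> G -> G)
    (brDl : forall a b c : G, br (a + b) c = br a c + br b c)
    (brDr : forall a b c : G, br a (b + c) = br a b + br a c) (n : nat)
    (psi : n.+1.-tuple G -> G) :
  bdiff br (bdiff br psi) = 0.
Proof.
have br0l c : br 0 c = 0 by apply: (addrI (br 0 c)); rewrite -brDl !addr0.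
have br0r c : br c 0 = 0 by apply: (addrI (br c 0)); rewrite -brDr !addr0.
apply/funext => x; rewrite bdiffE.
suff -> : orbit_sum (bdiff br psi) x = br 0 (orbit_sum psi x).
  by rewrite br0l br0r.
(* The [0] is expanded into the entry sums along the orbit; additivity on the left then gives one
   bracket per iterate, all with the same second argument. *)
rewrite -[X in br X _](sum_tsum_iter_fmap x).
rewrite (big_morph (br ^~ _) (fun a b => brDl a b _) (br0l _)).
by apply: eq_bigr => i _; rewrite bdiffE orbit_sum_iter_fmap.
Qed.

(** * Symmetric maps: tuples compared as multisets *)

Lemma symmetric_perm_eq (G : zmodType) (n : nat) (psi : n.-tuple G -> G)
    (x y : n.-tuple G) :
  symmetric_map psi -> perm_eq x y -> psi x = psi y.
Proof.
move=> sym /tuple_permP[s xE]; rewrite -(sym s y).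
by congr psi; apply/val_inj.
Qed.

(** Putting the replaced entry back describes the substituted tuple without deleting anything from a
    multiset. *)
Lemma subst_negsum_perm (G : zmodType) (n : nat) (i : 'I_n) (x : n.-tuple G) :
  perm_eq (tnth x i :: subst_negsum i x) (- tsum x :: x).
Proof.
have E (y : n.-tuple G) :
    perm_eq y (tnth y i :: [seq tnth y j | j <- enum 'I_n & j != i]).
  rewrite -{1}(map_tnth_enum y) -map_cons; apply: perm_map.
  by rewrite -rem_filter ?enum_uniq //; apply/perm_to_rem/mem_enum.
have := E x; rewrite -(perm_cons (- tsum x)) => /permPr ->.
have := E (subst_negsum i x); rewrite -(perm_cons (tnth x i)).
move=> /permPl ->; rewrite tnth_mktuple eqxx.
rewrite (eq_in_map _ (tnth x) _).1; last first.
  by move=> j; rewrite mem_filter tnth_mktuple => /andP[/negPf ->].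
by rewrite -cat1s -[X in perm_eq _ X]cat1s -!(cat1s _ (map _ _)) perm_catCA.
Qed.

Lemma bdiff_symmetricE (G : zmodType) (br : G -> G -> G) (n : nat)
    (psi : n.+1.-tuple G -> G) (x : n.+1.-tuple G) :
  symmetric_map psi ->
  bdiff br psi x =
  br (tsum x) (psi x + \sum_(i < n.+1) psi (subst_negsum i x)).
Proof.
move=> sym; rewrite /bdiff big_add1 /= big_mkord; congr (br _ (_ + _)).
(* The iterate [i.+1] lacks entry [i.+1] of [cyc x], which is [tnth x (ordS i)]; it therefore
   matches the substitution at [ordS i]. *)
rewrite [RHS](reindex_inj (@ordS_inj n.+1)); apply: eq_bigr => i _.
apply: symmetric_perm_eq sym _; rewrite -iterS.
have lt_in : (i.+1 < n.+2)%N by rewrite ltnS.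
rewrite -(perm_cons (tnth x (ordS i))) perm_sym.
apply: perm_trans (subst_negsum_perm _ _) _.
rewrite -(permPl (perm_cyc x)) -(nth_rot1 0).
(* The missing entry is the negated sum of the iterate, so adjoining it gives the multiset of a
   rotation of [cyc x]. *)
rewrite -[nth _ _ _]/((cyc x)`_i.+1) -[(cyc x)`_i.+1]opprK -tsum_iter_fmap //.
rewrite perm_sym -(permPl (perm_cyc _)) cyc_iter_fmap ?perm_rot //.
exact: ltnW.
Qed.

Lemma tsum_perm (G : zmodType) (n : nat) (s : 'S_n) (x : n.-tuple G) :
  tsum [tuple tnth x (s i) | i < n] = tsum x.
Proof.
rewrite /tsum [RHS](reindex_inj (@perm_inj _ s)).
by apply: eq_bigr => i _; rewrite tnth_mktuple.
Qed.

Lemma subst_negsum_permute (G : zmodType) (n : nat) (s : 'S_n) (i : 'I_n)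
    (x : n.-tuple G) :
  subst_negsum i [tuple tnth x (s j) | j < n] =
  [tuple tnth (subst_negsum (s i) x) (s j) | j < n].
Proof.
apply: eq_from_tnth => j.
by rewrite !tnth_mktuple tsum_perm (inj_eq perm_inj).
Qed.

(** Permuting the arguments by [s] fixes their sum and carries the substitution at [i] to the one at
    [s i], so the terms are only reordered. *)
Lemma bdiff_symmetric (G : zmodType) (br : G -> G -> G) (n : nat)
    (psi : n.+1.-tuple G -> G) :
  symmetric_map psi -> symmetric_map (bdiff br psi).
Proof.
move=> sym s x; rewrite !bdiff_symmetricE // tsum_perm sym.
congr (br _ (_ + _)); rewrite [RHS](reindex_inj (@perm_inj _ s)).
by apply: eq_bigr => i _; rewrite subst_negsum_permute sym.
Qed.

(** * Two arguments and parity *)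

Lemma tsum2 (G : zmodType) (x y : G) : tsum [tuple x; y] = x + y.
Proof. by rewrite tsumE !big_cons big_nil addr0. Qed.

Lemma fmap2 (G : zmodType) (x y : G) :
  fmap [tuple x; y] = [tuple - x - y; x].
Proof. by apply/val_inj; rewrite [LHS]val_fmap tsum2 opprD. Qed.

Lemma fmap2_fmap2 (G : zmodType) (x y : G) :
  fmap (fmap [tuple x; y]) = [tuple y; - x - y].
Proof.
rewrite !fmap2; apply/val_inj => /=; congr [:: _; _].
by rewrite opprD !opprK addrAC subrr add0r.
Qed.

Lemma bdiff2 (G : zmodType) (br : G -> G -> G) (psi : 2.-tuple G -> G)
    (x y : G) :
  bdiff br psi [tuple x; y] =
  br (x + y) (psi [tuple x; y]
              + (psi [tuple - x - y; x] + psi [tuple y; - x - y])).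
Proof.
rewrite /bdiff tsum2 big_nat_recl // big_nat1.
by rewrite -[iter 2 _ _]/(fmap (fmap _)) fmap2_fmap2 /= fmap2.
Qed.

Theorem proposition2p0p1 (G : zmodType) (br : G -> G -> G)
    (brDl : forall a b c : G, br (a + b) c = br a c + br b c)
    (brDr : forall a b c : G, br a (b + c) = br a b + br a c) :
  (forall n : nat, (2 <= n)%N ->
     (* (1) *)
     ((forall psi phi : n.-tuple G -> G,
         bdiff br (psi + phi) = bdiff br psi + bdiff br phi) /\
      (forall psi : n.-tuple G -> G, bdiff br (bdiff br psi) = 0)) /\
     (* (2) *)
     (forall psi : n.-tuple G -> G, symmetric_map psi ->
        symmetric_map (bdiff br psi) /\
        (forall x : n.-tuple G,
           bdiff br psi x =
           br (tsum x) (psi x + \sum_(i < n) psi (subst_negsum i x))))) /\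
  (* (3) *)
  ((forall x y : G, fmap [tuple x; y] = [tuple - x - y; x]) /\
   (forall x y : G, fmap (fmap [tuple x; y]) = [tuple y; - x - y]) /\
   (forall psi : 2.-tuple G -> G,
      ((forall x y : G, psi [tuple x; y] = psi [tuple y; x]) ->
       forall x y : G,
         bdiff br psi [tuple x; y] = bdiff br psi [tuple y; x]) /\
      ((forall x y : G, psi [tuple x; y] = - psi [tuple y; x]) ->
       forall x y : G,
         bdiff br psi [tuple x; y] = - bdiff br psi [tuple y; x]))).
Proof.
have brNr a b : br a (- b) = - br a b.
  apply: (addrI (br a b)); rewrite -brDr !subrr.
  by apply: (addrI (br a 0)); rewrite -brDr !addr0.
split=> [[//|n] _|].
  split; first by split; [exact: bdiffD | exact: bdiff_bdiff].
  move=> psi sym; split; first exact: bdiff_symmetric.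
  by move=> x; exact: bdiff_symmetricE.
split; first exact: fmap2.
split; first exact: fmap2_fmap2.
(* With [z = - x - y], exchanging [x] and [y] turns [(z, x)] into [(z, y)], the reverse of [(y, z)].
   The two orbit terms thus trade places, each with the sign of [psi]; in the odd case [brNr] moves
   this sign out of the bracket. *)
move=> psi; split=> par x y; rewrite !bdiff2 (addrC y x) (addrC (- y)).
  rewrite (par x y) (par (- x - y) x) (par y (- x - y)).
  by rewrite (addrC (psi [tuple x; _])).
rewrite (par x y) (par (- x - y) x) (par y (- x - y)) -brNr !opprD.
by rewrite (addrC (- psi [tuple x; _])).
Qed.
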